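(* Let $\Phi$ be an Orlicz function such that for some $\varepsilon,K_1,K_2>0$ the following conditions hold: $$\Phi(au)\ge K_1a^{2+\varepsilon}\Phi(u)\quad\text{for all }a,u\ge1,$$ $$\Phi(u+v)\le K_2\Phi(u)\Phi(v)\quad\text{for all }u,v\ge1.$$ Then there exist $\delta>0$ and $C>0$, depending on $\Phi$, such that for each $N\in\mathbb N$ one can find a family of symmetrically distributed independent functions $\{f_k\}_{k=1}^N\subset L_\Phi$, $\|f_k\|_{L_\Phi}=1$, $k=1,\dots,N$, such that for all $n\ge N^{1-\delta}$ it holds $$d_n(\{f_1,\dots,f_N\},L_\Phi)\le CN^{-\delta}.$$
   Context: Functions are real-valued and Lebesgue measurable on $[0,1]$; independence is with respect to Lebesgue measure. A function $f$ is symmetrically distributed if $f$ and $-f$ are identically distributed. Orlicz function: a strictly increasing, convex, continuous $\Phi:[0,\infty)\to[0,\infty)$ with $\Phi(0)=0$, $\Phi(1)=1$. Orlicz space $L_\Phi$: all measurable $x$ on $[0,1]$ with finite Luxemburg norm $\|x\|_{L_\Phi}:=\inf\{\lambda>0:\int_0^1\Phi(|x(t)|/\lambda)\,dt\le1\}$. Kolmogorov width: $d_n(K,X):=\inf_{\dim V\le n}\sup_{x\in K}\inf_{v\in V}\|x-v\|_X$, the infimum over linear subspaces $V\subset X$ of dimension at most $n$. *)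

(* Defs.v *)
From HB Require Import structures.
From mathcomp Require Import all_boot all_order all_algebra.
From mathcomp Require Import all_classical all_reals all_analysis.

Set Implicit Arguments.
Unset Strict Implicit.
Unset Printing Implicit Defensive.

Import Order.TTheory GRing.Theory Num.Theory.
Import numFieldNormedType.Exports.

Local Open Scope classical_set_scope.
Local Open Scope ring_scope.

(* The carrier R with the sigma-algebra of Lebesgue measurable (not merely
   Borel) sets, on which [completed_lebesgue_measure] is defined. *)
Notation lebesgueType R := (caratheodory_type (@wlength R idfun)^*%mu).

Section definitions.
Context {R : realType}.
Local Notation T := (lebesgueType R).
Local Notation mu := (@completed_lebesgue_measure R).

(* A function on [0,1] is represented by a function on the whole line, of
   which only the restriction to [0,1] is ever used. *)
Definition I01 : set T := [set t : R | 0 <= t <= 1].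

(* Likewise, only the restriction of [Phi] to [0,+oo[ matters; its
   nonnegativity there follows from monotonicity and [Phi 0 = 0]. *)
Definition orlicz_function (Phi : R -> R) : Prop :=
  [/\ {in `[0, +oo[ &, {homo Phi : u v / u < v}},
      convex_function (`[0, +oo[%classic : set R) Phi,
      {within `[0, +oo[, continuous Phi},
      Phi 0 = 0
    & Phi 1 = 1].

Definition luxemburg_norm (Phi : R -> R) (x : T -> R) : \bar R :=
  ereal_inf [set l%:E | l in [set l : R |
    0 < l /\ (\int[mu]_(t in I01) (Phi (`|x t| / l))%:E <= 1)%E]].

Definition orlicz_space (Phi : R -> R) : set (T -> R) :=
  [set x | measurable_fun I01 x /\ (luxemburg_norm Phi x < +oo)%E].

Definition identically_distributed (f g : T -> R) : Prop :=
  forall B : set R, measurable B ->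
    mu (I01 `&` f @^-1` B) = mu (I01 `&` g @^-1` B).

Definition symmetrically_distributed (f : T -> R) : Prop :=
  identically_distributed f (\- f).

(* Taking [B k = setT] for some of the k gives the product rule for every
   subfamily. *)
Definition independent_functions (N : nat) (f : 'I_N -> T -> R) : Prop :=
  forall B : 'I_N -> set R, (forall k, measurable (B k)) ->
    mu (I01 `&` \bigcap_k (f k @^-1` B k))
    = (\prod_(k < N) mu (I01 `&` f k @^-1` B k))%E.

(* [V] has dimension at most [n] once functions that agree almost everywhere
   on [0,1] are identified. *)
Definition dim_le (n : nat) (V : set (T -> R)) : Prop :=
  exists2 g : 'I_n -> T -> R, (forall i, V (g i)) &
    forall v, V v -> exists c : 'I_n -> R,
      {ae mu, forall t, I01 t -> v t = \sum_(i < n) c i * g i t}.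

Definition kolmogorov_width (n : nat) (K : set (T -> R)) (Phi : R -> R) :
    \bar R :=
  ereal_inf [set ereal_sup [set ereal_inf [set luxemburg_norm Phi (x \- v)
                                          | v in V]
                           | x in K]
            | V in [set V : set (T -> R) |
                [/\ submod_closed (mem V), V `<=` orlicz_space Phi
                  & dim_le n V]]].

End definitions.

(* Main.v *)
(* Let f_1, ..., f_N be independent, symmetric, with values in {-h, 0, h},
   P(f_k <> 0) = 1/N and Phi(h) = N, so that each f_k has norm 1.  Rank-n
   perturbations of the identity matrix come from polynomials P_1, ..., P_N of
   degree < 8 over the field with q = 2^m elements: two distinct ones agree at
   at most 7 points, so the functions g_(x,y) = sum_(j : P_j(x) = y) f_j, which
   span a space of dimension at most q^2, satisfy
     |f_k - q^-1 sum_x g_(x, P_k(x))| <= (7/q) sum_j |f_j| = (7 h / q) S,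
   where S counts the nonzero f_j.  Choose q^2 of order N^(1-delta).  By the
   growth condition Phi(h N^(-1/(2+eps))) is bounded by a constant, hence by the
   second condition Phi(s h N^(-1/(2+eps))) <= D^s, and the expectation of D^S
   is at most e^D because S is binomial with mean 1.  Since
   1/q = O(N^(-1/(2+eps) - delta)) for delta = eps/(3(2+eps)), the approximation
   error has norm O(N^-delta). *)
Require Import Defs.
From mathcomp Require Import all_boot all_order all_algebra all_field.
From mathcomp Require Import all_classical all_reals all_analysis.
From mathcomp Require Import ring lra.

Set Implicit Arguments.
Unset Strict Implicit.
Unset Printing Implicit Defensive.

Import Order.TTheory GRing.Theory Num.Theory.
Import numFieldNormedType.Exports.

Local Open Scope classical_set_scope.
Local Open Scope ring_scope.

(** * Codes with small pairwise agreement *)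

(** A nonzero polynomial of degree less than 8 has at most 7 roots, and a field with [2 ^ m]
    elements carries [(2 ^ m) ^ 8] such polynomials, enough for [N] distinct ones. *)
Lemma low_agreement_code (m N : nat) :
  (m == 0)%N || (N <= (2 ^ m) ^ 8)%N ->
  exists (F : finType) (P : 'I_N -> F -> F), #|F| = (2 ^ m)%N /\
    forall j k, j != k -> (#|[set x | P j x == P k x]%SET| <= 7)%N.
Proof.
case: (posnP m) => [-> _|m0].
  (* No field has one element, but on a single point any maps agree at most once, so [N] is
     unrestricted here. *)
  exists unit, (fun _ => id); split; first by rewrite card_unit.
  by move=> j k _; apply: leq_trans (max_card _) _; rewrite card_unit.
case: m m0 => // m _ /= leN.
have [F _ cF] := @pPrimePowerField 2 m.+1 isT isT.
have cV : #|{: 'rV[F]_8}| = ((2 ^ m.+1) ^ 8)%N by rewrite card_mx cF.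
have leV : (N <= #|{: 'rV[F]_8}|)%N by rewrite cV.
pose p (j : 'I_N) : {poly F} := rVpoly (enum_val (widen_ord leV j)).
exists F, (fun j x => (p j).[x]); split => // j k jk.
pose r := enum [set x | (p j).[x] == (p k).[x]]%SET.
rewrite cardE -/r -ltnS.
have pjk : p j - p k != 0.
  rewrite subr_eq0; apply: contra jk => /eqP /(can_inj rVpolyK) /enum_val_inj.
  by move=> /(congr1 (@nat_of_ord _)) /= /ord_inj ->.
apply: leq_trans (max_poly_roots pjk _ (enum_uniq _)) _.
  by apply/allP => x; rewrite mem_enum inE /root hornerD hornerN subr_eq0.
rewrite (leq_trans (size_polyD _ _))// size_polyN geq_max.
by rewrite !size_poly.
Qed.

(** * Functions on [0,1] that factor through a finite uniform probability space *)

Section equidistributed.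
Context {R : realType}.
Local Notation T := (lebesgueType R).
Local Notation mu := (@completed_lebesgue_measure R).

Lemma lebesgueType_measurable (A : set (measurableTypeR R)) :
  measurable A -> measurable (A : set T).
Proof. exact: sub_caratheodory. Qed.

Lemma measurable_I01 : measurable (@I01 R).
Proof.
have -> : @I01 R = `[0, 1]%classic by apply/seteqP; split => t /=; rewrite in_itv.
apply: lebesgueType_measurable; exact: measurable_itv.
Qed.

Variables (Omega : finType) (w0 : Omega).
Let L : R := #|Omega|%:R.

Let L_gt0 : 0 < L.
Proof. by rewrite ltr0n; apply/card_gt0P; exists w0. Qed.

(* At [t = 1] the index is out of range, and the default [w0] is returned. *)
Definition cell (t : T) : Omega :=
  nth w0 (enum Omega) (Num.trunc ((t : R) * L)).

Let cell_set (w : Omega) : set T := I01 `&` cell @^-1` [set w].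

(** The endpoint 1 lies in no half-open interval and goes to the default [w0]; being a null set, it
    leaves all cells of equal measure. *)
Lemma cell_setE (w : Omega) (i := (index w (enum Omega))%:R : R) :
  cell_set w = `[i / L, (i + 1) / L[%classic `|`
     (if w == w0 then [set 1 : R] else set0).
Proof.
have szE : size (enum Omega) = #|Omega| by rewrite -cardE.
have wi : (index w (enum Omega) < #|Omega|)%N by rewrite -szE index_mem mem_enum.
apply/seteqP; split=> [t [/andP[t0 t1] /= wE]|t].
  have [tE|t1'] := eqVneq (t : R) 1.
    by right; rewrite -wE /cell tE mul1r natrK nth_default ?szE// eqxx.
  left; rewrite /= in_itv/=.
  have ltL : (Num.trunc ((t : R) * L) < #|Omega|)%N.
    rewrite truncn_lt_nat ?mulr_ge0 ?(ltW L_gt0)//.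
    by rewrite -[ltRHS]mul1r ltr_pM2r// lt_neqAle t1' t1.
  rewrite /i -wE /cell index_uniq ?szE ?enum_uniq//.
  rewrite ler_pdivrMr// ltr_pdivlMr//.
  have := @truncn_itv _ ((t : R) * L); rewrite -[_.+1]addn1 natrD; apply.
  by rewrite mulr_ge0 ?(ltW L_gt0).
case.
  rewrite /= in_itv /= ler_pdivrMr// ltr_pdivlMr// => /andP[lo hi].
  have t0 : 0 <= (t : R).
    by rewrite -(pmulr_lge0 _ L_gt0); apply: le_trans lo; rewrite ler0n.
  have t1 : (t : R) <= 1.
    rewrite -(ler_pM2r L_gt0) mul1r; apply: le_trans (ltW hi) _.
    by rewrite natr1 ler_nat.
  split; first by apply/andP.
  rewrite /= /cell (@truncn_def _ _ (index w (enum Omega))) ?nth_index ?mem_enum//.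
  by rewrite -natr1 lo hi.
case: eqP => // -> /= ->; split; first by rewrite /I01 /= ler01 lexx.
by rewrite /= /cell mul1r natrK nth_default ?szE.
Qed.

Lemma measurable_cell_set w : measurable (cell_set w).
Proof.
rewrite cell_setE; apply: measurableU.
  by apply: lebesgueType_measurable; exact: measurable_itv.
by case: eqP => _; [by apply: lebesgueType_measurable; exact: measurable_set1|exact: measurable0].
Qed.

Lemma measure_cell_set w : mu (cell_set w) = (L^-1)%:E.
Proof.
rewrite cell_setE measureU0.
- rewrite [LHS]lebesgue_measure_itv /= lte_fin.
  rewrite ltr_pM2r ?invr_gt0// ltrDl ltr01 -EFinB; congr EFin.
  by rewrite mulrDl mul1r addrAC subrr add0r.
- by apply: lebesgueType_measurable; exact: measurable_itv.
- case: eqP => _; last exact: measurable0.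
  by apply: lebesgueType_measurable; exact: measurable_set1.
- case: eqP => _; last exact: measure0.
  exact: lebesgue_measure_set1.
Qed.

Lemma cell_preimageE (P : pred Omega) :
  I01 `&` [set t : T | P (cell t)] = \big[setU/set0]_(w <- enum P) cell_set w.
Proof.
rewrite -bigcup_seq; apply/seteqP; split=> [t [It Pt]|t [w /= ws [It /= wE]]].
  by exists (cell t) => //=; rewrite mem_enum.
by split => //=; rewrite wE; move: ws; rewrite mem_enum.
Qed.

Lemma measurable_cell_preimage (P : pred Omega) :
  measurable (I01 `&` [set t : T | P (cell t)]).
Proof.
by rewrite cell_preimageE; apply: bigsetU_measurable => w _; exact: measurable_cell_set.
Qed.

Lemma measurable_preimage_cell (S : Type) (g : Omega -> S) (Y : set S) :
  measurable (I01 `&` (g \o cell) @^-1` Y).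
Proof.
have -> : I01 `&` (g \o cell) @^-1` Y = I01 `&` [set t : T | `[< Y (g (cell t)) >]].
  by congr (_ `&` _); apply/seteqP; split => t /= /asboolP.
exact: (measurable_cell_preimage (fun w => `[< Y (g w) >])).
Qed.

(** Reduces the integrals in Luxemburg norms to finite averages. *)
Lemma integral_cell (g : Omega -> R) : (forall w, 0 <= g w) ->
  (\int[mu]_(t in I01) (g (cell t))%:E)%E = ((\sum_w g w) / L)%:E.
Proof.
move=> g0.
have I01E : @I01 R = \big[setU/set0]_(w <- enum predT) cell_set w.
  rewrite -cell_preimageE; apply/seteqP; split => [t It|t []]//.
rewrite {1}I01E ge0_integral_bigsetU.
- rewrite (eq_bigr (fun w => (g w / L)%:E)); last first.
    move=> w _; rewrite (@eq_integral _ _ _ _ _ (cst (g w)%:E)).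
      rewrite integral_cst; last exact: measurable_cell_set.
      by rewrite EFinM; congr (_ * _)%E; exact: measure_cell_set.
    by move=> t; rewrite inE => -[_ /= <-].
  by rewrite big_enum /= sumEFin -mulr_suml.
- exact: measurable_cell_set.
- exact: enum_uniq.
- exact: trivIset_preimage1_in.
- rewrite -I01E.
  by move=> _ Y _; exact: (measurable_preimage_cell (fun w => (g w)%:E)).
- by move=> t _; rewrite lee_fin.
Qed.

Lemma measure_cell_preimage (P : pred Omega) :
  mu (I01 `&` [set t : T | P (cell t)]) = ((\sum_w (P w)%:R) / L)%:E.
Proof.
set A := _ `&` _; have mA : measurable A by exact: measurable_cell_preimage.
transitivity (\int[mu]_(t in I01) (\1_A t)%:E)%E.
  rewrite integral_indic//; last exact: measurable_I01.
  by rewrite (setIidl (@subIsetl _ _ _)).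
rewrite (@eq_integral _ _ _ _ _ (fun t => ((P (cell t))%:R : R)%:E)).
  by rewrite (integral_cell (g := fun w => (P w)%:R)).
move=> t; rewrite inE => It; rewrite indicE; congr ((_ %:R)%:E); congr nat_of_bool.
by apply/idP/idP; rewrite inE => //= -[].
Qed.

End equidistributed.

(** * Orlicz functions, and norms and widths of finitely valued functions *)

Section orlicz.
Context {R : realType} (Phi : R -> R).
Hypothesis orlPhi : orlicz_function Phi.

Lemma orlicz_homo (u v : R) : 0 <= u -> u <= v -> Phi u <= Phi v.
Proof.
case: orlPhi => incPhi _ _ _ _ u0; rewrite le_eqVlt => /predU1P[->//|uv].
apply/ltW/incPhi => //; rewrite in_itv /= andbT //.
exact: le_trans u0 (ltW uv).
Qed.

Lemma orlicz_ge0 (u : R) : 0 <= u -> 0 <= Phi u.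
Proof. by case: orlPhi => _ _ _ P0 _ u0; rewrite -P0 orlicz_homo. Qed.

(** Convexity on the segment from 0 to [u], together with [Phi 0 = 0]. *)
Lemma orlicz_scale (t u : R) : 0 <= t <= 1 -> 0 <= u -> Phi (t * u) <= t * Phi u.
Proof.
case: orlPhi => _ cvxPhi _ P0 _ /andP[t0 t1] u0.
have t01 : Itv.spec (@Itv.num_sem R) (Itv.Real `[0%Z, 1%Z]) t.
  by rewrite /= /Itv.num_sem/= num_real/= in_itv/= t0 t1.
have /= := cvxPhi (Itv.mk t01) u 0.
rewrite !inE/= !in_itv/= u0 lexx => /(_ isT isT).
by rewrite convRE /= P0 mulr0 addr0 /conv /= scaler0 addr0.
Qed.

Lemma orlicz_value (y : R) : 1 <= y -> exists2 h : R, 1 <= h & Phi h = y.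
Proof.
case: orlPhi => _ _ ctsPhi _ P1 y1.
have y0 : 0 < y by exact: lt_le_trans y1.
(* Scaling [y] down to 1 by convexity gives this, so [1, y] serves for the intermediate value
   theorem. *)
have yP : y <= Phi y.
  have := @orlicz_scale y^-1 y; rewrite mulVf ?gt_eqF// P1 mulrC -ler_pdivrMr ?invr_gt0//.
  by rewrite invrK mul1r; apply; rewrite ?invr_ge0 ?invf_le1 // ltW.
have [||h hy Ph] := @IVT R Phi 1 y y y1.
- apply: continuous_subspaceW ctsPhi => x /=; rewrite !in_itv/= andbT => /andP[x1 _].
  exact: le_trans x1.
- by rewrite P1 ge_min y1 /= le_max yP orbT.
- by exists h => //; move: hy; rewrite in_itv /= => /andP[].
Qed.

(** Each further copy of [u] costs a factor [K2 * Phi u]. The maximum with 1 keeps the bound valid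
    for a single copy, where the induction starts because both summands must be at least 1. *)
Lemma orlicz_multiple (K2 B u : R) :
  (forall u v, 1 <= u -> 1 <= v -> Phi (u + v) <= K2 * Phi u * Phi v) ->
  1 <= u -> Phi u <= B -> 1 <= B ->
  forall s : nat, Phi (s%:R * u) <= (B * Num.max 1 K2) ^+ s.
Proof.
move=> addPhi u1 PB B1; case=> [|s].
  by case: orlPhi => _ _ _ P0 _; rewrite mul0r P0 expr0 ler01.
have B0 : 0 <= B by exact: le_trans B1.
have u0 : 0 <= u by exact: le_trans u1.
elim: s => [|s IH].
  by rewrite mul1r expr1 (le_trans PB)// ler_peMr// le_max lexx.
rewrite -natr1 mulrDl mul1r.
have su1 : 1 <= s.+1%:R * u by rewrite -[leLHS]mul1r ler_pM ?ler01 // ler1n.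
apply: le_trans (addPhi _ _ su1 u1) _.
have [P0 Q0] := (orlicz_ge0 (le_trans ler01 su1), orlicz_ge0 u0).
have M0 : 0 <= Num.max 1 K2 by rewrite le_max ler01.
apply: le_trans (_ : Num.max 1 K2 * Phi (s.+1%:R * u) * Phi u <= _).
  by rewrite !ler_wpM2r// le_max lexx orbT.
rewrite exprSr -mulrA (mulrC (Num.max 1 K2)) -mulrA.
by rewrite ler_pM ?mulr_ge0// ler_wpM2r.
Qed.

Lemma le_luxemburg_norm (Omega : finType) (w0 : Omega) (g : Omega -> R) (l : R) :
  0 < l -> \sum_w Phi (`|g w| / l) <= #|Omega|%:R ->
  (luxemburg_norm Phi (g \o cell w0) <= l%:E)%E.
Proof.
move=> l0 sum_le; apply: ereal_inf_lbound => /=; exists l => //; split => //.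
rewrite (integral_cell w0 (g := fun w => Phi (`|g w| / l))) => [|w].
  by rewrite lee_fin ler_pdivrMr ?mul1r// ltr0n; apply/card_gt0P; exists w0.
by rewrite orlicz_ge0// divr_ge0// ltW.
Qed.

Lemma orlicz_space_cell (Omega : finType) (w0 : Omega) (g : Omega -> R) :
  orlicz_space Phi (g \o cell w0).
Proof.
split; first by move=> _ Y _; exact: measurable_preimage_cell.
(* At this scale all values are at most 1, where [Phi] is at most 1. *)
pose l := 1 + \sum_w `|g w|.
have l0 : 0 < l by rewrite ltr_pwDl// sumr_ge0.
apply: le_lt_trans (le_luxemburg_norm w0 l0 _) (ltry _).
rewrite -sum1_card natr_sum ler_sum// => w _.
case: orlPhi => _ _ _ _ P1; rewrite -[leRHS]P1 orlicz_homo ?divr_ge0 ?(ltW l0)//.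
rewrite ler_pdivrMr// mul1r /l (bigD1 w)//= addrCA lerDl.
by rewrite addr_ge0 ?sumr_ge0.
Qed.

(** The competing subspace is the span of the [gen i], pulled back by [cell]; row [k] of [c] gives
    the approximant of [f k]. *)
Lemma kolmogorov_width_cell (Omega : finType) (w0 : Omega) (N n : nat)
    (f : 'I_N -> Omega -> R) (gen : 'I_n -> Omega -> R) (c : 'I_N -> 'I_n -> R)
    (l : R) :
  0 < l ->
  (forall k, \sum_w Phi (`|f k w - \sum_(i < n) c k i * gen i w| / l)
               <= #|Omega|%:R) ->
  (kolmogorov_width n (range (fun k => f k \o cell w0)) Phi <= l%:E)%E.
Proof.
move=> l0 fl.
pose comb (a : 'I_n -> R) (w : Omega) : R := \sum_(i < n) a i * gen i w.
pose V : set (lebesgueType R -> R) := range (fun a => comb a \o cell w0).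
apply: (@le_trans _ _ (ereal_sup [set ereal_inf [set luxemburg_norm Phi (x \- v)
  | v in V] | x in range (fun k => f k \o cell w0)])).
  apply: ereal_inf_lbound; exists V => //; split.
  - split.
      rewrite inE; exists (fun=> 0) => //; apply/funext => t /=.
      by rewrite /comb big1// => i _; rewrite mul0r.
    move=> a u v; rewrite !inE => -[cu _ <-] [cv _ <-].
    exists (fun i => a * cu i + cv i) => //; apply/funext => t /=.
    transitivity (a * comb cu (cell w0 t) + comb cv (cell w0 t)) => //.
    rewrite /comb mulr_sumr -big_split; apply: eq_bigr => i _.
    by rewrite mulrDl mulrA.
  - by move=> _ [a _ <-]; exact: orlicz_space_cell.
  - exists (fun i => gen i \o cell w0) => [i|_ [a _ <-]].
      exists (fun j => (j == i)%:R) => //; apply/funext => t /=.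
      rewrite /comb (bigD1 i)//= eqxx mul1r big1 ?addr0// => j /negbTE ->.
      by rewrite mul0r.
    by exists a; apply: aeW.
apply: ge_ereal_sup => _ [_ [k _ <-] <-].
apply: ereal_inf_le; exists (luxemburg_norm Phi ((f k \- comb (c k)) \o cell w0)).
  by exists (comb (c k) \o cell w0) => //; exists (c k).
exact: (le_luxemburg_norm w0 l0 (fl k)).
Qed.

(** At [l = 1] the integral is exactly 1. For [l < 1] strict monotonicity pushes it above 1, since
    the support has positive measure. *)
Lemma luxemburg_norm_eq1 (Omega : finType) (w0 : Omega) (g : Omega -> R)
    (h : R) (P : pred Omega) :
  0 < h -> (forall w, `|g w| = h * (P w)%:R) ->
  Phi h * (\sum_w (P w)%:R) = #|Omega|%:R ->
  luxemburg_norm Phi (g \o cell w0) = 1%E.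
Proof.
case: orlPhi => incPhi _ _ Phi0 _ h0 gE cE.
have sumE l : \sum_w Phi (`|g w| / l) = Phi (h / l) * (\sum_w (P w)%:R).
  rewrite mulr_sumr; apply: eq_bigr => w _; rewrite gE.
  by case: (P w); rewrite ?mulr1// !mulr0 mul0r.
have Omega0 : 0 < #|Omega|%:R :> R by rewrite ltr0n; apply/card_gt0P; exists w0.
apply/eqP; rewrite eq_le; apply/andP; split.
  by apply: le_luxemburg_norm => //; rewrite sumE divr1 cE.
apply: le_ereal_inf_tmp => _ [l [l0 intl] <-].
rewrite lee_fin leNgt; apply/negP => l1; move: intl.
rewrite (integral_cell w0 (g := fun w => Phi (`|g w| / l))) => [|w]; last first.
  by rewrite orlicz_ge0// divr_ge0// ltW.
rewrite lee_fin ler_pdivrMr// mul1r sumE -cE; apply/negP; rewrite -ltNge.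
rewrite ltr_pM2r.
  by apply: incPhi; rewrite ?in_itv/= ?andbT ?divr_ge0 ?ltW// ltr_pdivlMr// gtr_pMr.
rewrite lt_neqAle sumr_ge0 ?andbT//.
by apply/eqP => P0; move: Omega0; rewrite -cE -P0 mulr0 ltxx.
Qed.
End orlicz.

(** * Coordinates on a finite product space: independence, symmetry, exponential moments *)

Section product_space.
Context {R : realType} (A : finType) (N : nat).
Local Notation Omega := {ffun 'I_N -> A}.
Local Notation mu := (@completed_lebesgue_measure R).
Implicit Types (k : 'I_N) (w : Omega) (v : A -> R).

Lemma sum_prod_coord (F : 'I_N -> A -> R) :
  \sum_(w : Omega) \prod_k F k (w k) = \prod_k \sum_a F k a.
Proof. by rewrite bigA_distr_bigA. Qed.

Lemma sum_coord k (F : A -> R) :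
  \sum_(w : Omega) F (w k) = (\sum_a F a) * #|A|%:R ^+ N.-1.
Proof.
(* Padding with constants 1 makes the summand a product over all coordinates. *)
pose G j : A -> R := if j == k then F else fun=> 1.
transitivity (\sum_(w : Omega) \prod_j G j (w j)).
  apply: eq_bigr => w _; rewrite (bigD1 k)//= /G eqxx big1 ?mulr1//.
  by move=> j /negbTE ->.
rewrite sum_prod_coord (bigD1 k)//= /G eqxx; congr (_ * _).
rewrite (eq_bigr (fun=> #|A|%:R)) => [|j /negbTE ->].
  by rewrite prodr_const cardC1 card_ord.
by rewrite sumr_const.
Qed.

Variable w0 : Omega.

Lemma card_product_space : #|Omega|%:R = #|A|%:R ^+ N :> R.
Proof. by rewrite card_ffun card_ord natrX. Qed.

Lemma measure_coord k v (B : set R) :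
  mu (I01 `&` (fun t : lebesgueType R => v (cell w0 t k)) @^-1` B)
  = ((\sum_a `[< B (v a) >]%:R) / #|A|%:R)%:E.
Proof.
have -> : (fun t : lebesgueType R => v (cell w0 t k)) @^-1` B =
    [set t : lebesgueType R | `[< B (v (cell w0 t k)) >]].
  by apply/seteqP; split => t /= /asboolP.
rewrite (measure_cell_preimage w0 (fun w => `[< B (v (w k)) >])).
rewrite (sum_coord k (fun a => `[< B (v a) >]%:R)) card_product_space.
have A0 : #|A|%:R != 0 :> R by rewrite pnatr_eq0 -lt0n; apply/card_gt0P; exists (w0 k).
have -> : #|A|%:R ^+ N = #|A|%:R * #|A|%:R ^+ N.-1 :> R.
  by rewrite -exprS prednK// (leq_ltn_trans _ (ltn_ord k)).
by congr EFin; field; rewrite A0 expf_neq0.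
Qed.

(** The indicator of an intersection of coordinate events is a product of indicators, so its sum
    over [Omega] factors. *)
Lemma independent_coord v :
  independent_functions (fun k t => v (cell w0 t k)).
Proof.
move=> B _.
under eq_bigr do rewrite measure_coord.
rewrite prodEFin.
have -> : \bigcap_k ((fun t : lebesgueType R => v (cell w0 t k)) @^-1` B k) =
    [set t : lebesgueType R | [forall k, `[< B k (v (cell w0 t k)) >]]].
  apply/seteqP; split => t /= Bt.
    by apply/forallP => k; apply/asboolP; exact: Bt.
  by move=> k _; apply/asboolP; exact: (forallP Bt k).
rewrite (measure_cell_preimage w0 (fun w => [forall k, `[< B k (v (w k)) >]])).
rewrite card_product_space big_split /= prodr_const card_ord exprVn.
rewrite -(sum_prod_coord (fun k a => `[< B k (v a) >]%:R)).
congr ((_ / _)%:E); apply: eq_bigr => w _.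
case: (boolP [forall k, _]) => [/forallP Bw|].
  by rewrite big1// => k _; rewrite Bw.
rewrite negb_forall => /existsP[k /negbTE NBk].
by rewrite (bigD1 k)//= NBk mul0r.
Qed.

(** The involution permutes the uniform space [A] and flips the sign of [v]. *)
Lemma symmetric_coord k v (s : A -> A) :
  involutive s -> (forall a, v (s a) = - v a) ->
  symmetrically_distributed (fun t : lebesgueType R => v (cell w0 t k)).
Proof.
move=> sK vs B _; rewrite measure_coord.
rewrite (_ : \- _ = fun t => (\- v) (cell w0 t k))// measure_coord.
congr ((_ / _)%:E); rewrite (reindex_inj (inv_inj sK)) /=.
by apply: eq_bigr => a _; rewrite vs.
Qed.

(** Here [P] has probability 1/N. Each coordinate contributes the mean 1 + (D - 1)/N <= exp((D -
    1)/N), and the N-fold product is at most exp(D - 1). *)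
Lemma sum_expr_count (P : pred A) (D : R) :
  1 <= D -> (0 < N)%N -> #|A|%:R = N%:R * (\sum_a (P a)%:R) :> R ->
  \sum_(w : Omega) D ^+ (\sum_k P (w k))%N <= #|Omega|%:R * expR D.
Proof.
move=> D1 N0 cA; rewrite card_product_space.
under eq_bigr do rewrite -prodrXr.
rewrite (sum_prod_coord (fun _ a => D ^+ P a)) prodr_const card_ord.
have N0' : N%:R != 0 :> R by rewrite pnatr_eq0 -lt0n.
have -> : \sum_a D ^+ P a = #|A|%:R * (1 + (D - 1) / N%:R).
  rewrite mulrDr mulr1 {2}cA -[#|A|]sum1_card natr_sum.
  rewrite [X in _ + X](_ : _ = (D - 1) * (\sum_a (P a)%:R)); last by field.
  rewrite mulr_sumr -big_split; apply: eq_bigr => a _.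
  by case: (P a); rewrite /= ?expr1 ?expr0 ?mulr1 ?mulr0 ?addr0 // addrC subrK.
rewrite exprMn ler_wpM2l ?exprn_ge0//.
have DN0 : 0 <= (D - 1) / N%:R by rewrite divr_ge0 ?subr_ge0.
apply: (@le_trans _ _ (expR ((D - 1) / N%:R) ^+ N)).
  by rewrite lerXn2r ?nnegrE ?addr_ge0 ?expR_ge0// expR_ge1Dx.
by rewrite -expRM_natl mulrC divfK// ler_expR gerBl.
Qed.
End product_space.

(** * Low-rank approximation from a code, and the choice of the field size *)

Section approximation.
Context {R : realType}.

(** Averaging the generators along the graph of [P k] gives [X j] the weight [m j k / #|F|], the
    fraction of points where [P j] and [P k] agree: 1 for [j = k], at most 7/q otherwise, where q is
    [#|F|]. *)
Lemma low_agreement_approx (Omega F : finType) (N n : nat)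
    (P : 'I_N -> F -> F) (X : 'I_N -> Omega -> R) :
  (0 < #|F|)%N -> (#|F| ^ 2 <= n)%N ->
  (forall j k, j != k -> (#|[set x | P j x == P k x]%SET| <= 7)%N) ->
  exists (gen : 'I_n -> Omega -> R) (c : 'I_N -> 'I_n -> R), forall k w,
    `|X k w - \sum_(i < n) c k i * gen i w|
      <= 7 / #|F|%:R * \sum_j `|X j w|.
Proof.
move=> q0 len agree; have [x0 _] := card_gt0P q0.
have q0' : 0 < #|F|%:R :> R by rewrite ltr0n.
have leI : (#|{: F * F}| <= n)%N by rewrite card_prod mulnn.
(* Indices beyond [#|F| ^ 2] decode to the default pair; they lie outside the image of [phi], so [c]
   gives them weight 0. *)
pose psi (i : 'I_n) : F * F := nth (x0, x0) (enum {: F * F}) i.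
pose phi (p : F * F) : 'I_n := widen_ord leI (enum_rank p).
have phiK p : psi (phi p) = p by rewrite /psi /= nth_enum_rank.
pose gen i w : R := \sum_j (P j (psi i).1 == (psi i).2)%:R * X j w.
pose c k i : R := \sum_x (i == phi (x, P k x))%:R / #|F|%:R.
pose m j k : R := #|[set x | P j x == P k x]%SET|%:R.
have mE j k : m j k = \sum_x (P j x == P k x)%:R.
  rewrite /m -sum1_card natr_sum big_mkcond /=.
  by apply: eq_bigr => x _; rewrite inE; case: eqP.
exists gen, c => k w.
have -> : \sum_(i < n) c k i * gen i w = \sum_j m j k / #|F|%:R * X j w.
  transitivity (\sum_x #|F|%:R^-1 * gen (phi (x, P k x)) w).
    under eq_bigr do rewrite mulr_suml; rewrite exchange_big /=.
    apply: eq_bigr => x _; rewrite (bigD1 (phi (x, P k x)))//= eqxx mul1r.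
    by rewrite big1 ?addr0// => i /negbTE ->; rewrite !mul0r.
  under eq_bigr do rewrite mulr_sumr; rewrite exchange_big /=.
  apply: eq_bigr => j _; rewrite mE !mulr_suml; apply: eq_bigr => x _.
  by rewrite phiK mulrA [_^-1 * _]mulrC.
have mkk : m k k = #|F|%:R.
  by rewrite /m; congr (_%:R); apply: eq_card => x; rewrite !inE eqxx.
rewrite (bigD1 k)//= mkk divff ?gt_eqF// mul1r opprD addrA subrr add0r normrN.
apply: le_trans (ler_norm_sum _ _ _) _.
(* The term [j = k] has cancelled on the left and is nonnegative on the right. *)
rewrite mulr_sumr [leRHS](bigD1 k)//= -[leLHS]add0r lerD//.
apply: ler_sum => j jk; rewrite normrM ler_wpM2r//.
rewrite ger0_norm ?divr_ge0 ?ler0n// ler_pM2r ?invr_gt0//.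
by rewrite (ler_nat R _ 7) agree.
Qed.

(** Take [4 ^ m] to be the largest power of 4 not exceeding N^(1-delta); rounding costs at most a
    factor 2 in [2 ^ m]. *)
Lemma dyadic_scale (N : nat) (delta : R) : (0 < N)%N -> delta <= 2^-1 ->
  exists m : nat, [/\ (m == 0)%N || (N <= (2 ^ m) ^ 8)%N,
    forall n : nat, N%:R `^ (1 - delta) <= n%:R -> ((2 ^ m) ^ 2 <= n)%N &
    N%:R `^ ((1 - delta) / 2) <= 2 * (2 ^ m)%:R].
Proof.
move=> N0 delta2.
have N1 : 1 <= N%:R :> R by rewrite ler1n.
have hdelta : 2^-1 <= 1 - delta by lra.
set y := N%:R `^ (1 - delta).
have y1 : 1 <= y by rewrite -(powRr0 N%:R) ler_powR// subr_ge0; lra.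
have y0 : 0 <= y by exact: le_trans y1.
pose r := Num.trunc y; have /andP[ry yr] := truncn_itv y0.
have r0 : (0 < r)%N by have := le_lt_trans y1 yr; rewrite ltr1n.
pose m := trunc_log 4 r.
have mr : (4 ^ m <= r)%N by exact: trunc_logP.
have rm : (r < 4 ^ m.+1)%N by exact: trunc_log_ltn.
have ym : y < (4 ^ m.+1)%:R by apply: lt_le_trans yr _; rewrite ler_nat.
have sq : ((2 ^ m) ^ 2 = 4 ^ m)%N by rewrite -expnM mulnC expnM.
exists m; split.
- case: (posnP m) => //= m0.
  have hN : N%:R `^ 2^-1 <= y by rewrite /y ler_powR.
  have : N%:R <= (4 ^ m.+1)%:R ^+ 2 :> R.
    have -> : N%:R = (N%:R `^ 2^-1) ^+ 2 :> R.
      by rewrite -powR_mulrn ?powR_ge0// -powRrM mulVf// powRr1.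
    by rewrite lerXn2r ?nnegrE ?powR_ge0// (le_trans hN)// ltW.
  rewrite -natrX ler_nat => /leq_trans; apply.
  (* Comparing exponents leaves 4(m + 1) <= 8m, true for m >= 1; this is why the codes use 8
     coefficients. *)
  rewrite -[4%N]/(2 ^ 2)%N -!expnM leq_exp2l// [(m.+1 * 2)%N]mulnC mulnA [leqLHS]mulnC.
  rewrite -[(2 * 2)%N]/4%N -[8%N]/(2 * 4)%N mulnA leq_mul2r /=.
  by rewrite -addn1 muln2 -addnn leq_add2l.
- move=> n yn; rewrite sq (leq_trans mr)// -(ler_nat R).
  exact: le_trans ry yn.
- rewrite powRrM powR12_sqrt//.
  rewrite -(@ler_sqr R) ?nnegrE ?sqrtr_ge0 ?mulr_ge0//.
  rewrite sqr_sqrtr// exprMn -[(2 ^ m)%:R ^+ 2]natrX sq.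
  apply: le_trans (ltW ym) _.
  by rewrite expnS natrM -natrX.
Qed.
End approximation.

(** * The random family and its error estimate *)

Theorem corollary3p15 (R : realType) (Phi : R -> R) (eps K1 K2 : R) :
  orlicz_function Phi ->
  0 < eps -> 0 < K1 -> 0 < K2 ->
  (forall a u : R, 1 <= a -> 1 <= u ->
    K1 * a `^ (2 + eps) * Phi u <= Phi (a * u)) ->
  (forall u v : R, 1 <= u -> 1 <= v -> Phi (u + v) <= K2 * Phi u * Phi v) ->
  exists delta C : R, [/\ 0 < delta, 0 < C &
    forall N : nat, (0 < N)%N ->
      exists f : 'I_N -> lebesgueType R -> R,
        [/\ forall k, orlicz_space Phi (f k),
            forall k, symmetrically_distributed (f k),
            independent_functions f,
            forall k, luxemburg_norm Phi (f k) = 1%E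
          & forall n : nat, N%:R `^ (1 - delta) <= n%:R ->
              (kolmogorov_width n (range f) Phi
               <= (C * N%:R `^ (- delta))%:E)%E]].
Proof.
move=> orlPhi eps0 K10 K20 growPhi addPhi.
pose delta := eps / (3 * (2 + eps)).
pose gamma := (2 + eps)^-1.
have e2 : 0 < 2 + eps by lra.
have delta0 : 0 < delta by rewrite divr_gt0// mulr_gt0.
have delta2 : delta <= 2^-1 by rewrite ler_pdivrMr ?mulr_gt0//; lra.
(* This balance fixes [delta]: of the gain 1/q, the part N^(-gamma) offsets the height [h] and
   N^(-delta) remains as the rate. *)
have dg : (1 - delta) / 2 = delta + gamma by rewrite /delta /gamma; field; lra.
pose B := Num.max 1 K1^-1.
pose D := B * Num.max 1 K2.
have B1 : 1 <= B by rewrite le_max lexx.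
have D1 : 1 <= D by rewrite -[leLHS]mul1r ler_pM ?ler01// le_max lexx.
(* 14 is 7 agreements times the rounding factor 2; [expR D] will pay for the exponential moment. *)
pose C := 14 * expR D.
have C0 : 0 < C by rewrite mulr_gt0 ?expR_gt0.
exists delta, C; split => // N N0.
have NR0 : 0 < N%:R :> R by rewrite ltr0n.
have N1 : 1 <= N%:R :> R by rewrite ler1n.
have [h h1 Ph] := orlicz_value orlPhi N1.
have h0 : 0 < h by exact: lt_le_trans h1.
(* A letter is a sign with a uniform index; index 0 is the event of probability 1/N on which [v] is
   nonzero. *)
pose A : finType := (bool * 'I_N)%type.
pose hit (a : A) : bool := val a.2 == 0%N.
pose v (a : A) : R := h * ((hit a)%:R * (-1) ^+ a.1).
pose a0 : A := (true, Ordinal N0).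
pose w0 : {ffun 'I_N -> A} := [ffun=> a0].
have cA : #|A|%:R = 2 * N%:R :> R by rewrite card_prod card_bool card_ord natrM.
have sum_hit : \sum_a (hit a)%:R = 2 :> R.
  rewrite -(pair_big xpredT xpredT (fun b i => (hit (b, i))%:R)) /=.
  rewrite big_bool /= (bigD1 (Ordinal N0))//= big1 => [|i].
    by rewrite addr0 -mulr2n.
  by rewrite -val_eqE /hit /= => /negbTE ->.
have normv a : `|v a| = h * (hit a)%:R.
  by rewrite /v normrM gtr0_norm// normrM normrX normrN1 expr1n mulr1 ger0_norm.
pose f k (w : {ffun 'I_N -> A}) := v (w k).
exists (fun k => f k \o cell w0); split.
- by move=> k; exact: orlicz_space_cell.
- move=> k; apply: (symmetric_coord w0 k (s := fun a => (~~ a.1, a.2))).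
    by case=> b i /=; rewrite negbK.
  by move=> [b i]; rewrite /v /hit /=; case: b; rewrite /= ?expr0 ?expr1; ring.
- exact: independent_coord.
- move=> k; apply: (luxemburg_norm_eq1 orlPhi w0 h0 (fun w => normv (w k))).
  rewrite (sum_coord k (fun a => (hit a)%:R)) sum_hit Ph card_product_space cA.
  by rewrite -[in RHS](prednK N0) exprS prednK//; ring.
move=> n leNn.
have [m [codeN /(_ n leNn) len scale]] := dyadic_scale N0 delta2.
have [F [P [cF agree]]] := low_agreement_code codeN.
rewrite -cF in len scale.
have q0 : (0 < #|F|)%N by rewrite cF expn_gt0.
have q0' : 0 < #|F|%:R :> R by rewrite ltr0n.
have [gen [c approx]] := low_agreement_approx f q0 len agree.
pose l := C * N%:R `^ (- delta).
have l0 : 0 < l by rewrite mulr_gt0// powR_gt0.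
apply: (kolmogorov_width_cell orlPhi w0 (gen := gen) (c := c) l0) => k.
pose u := h * N%:R `^ (- gamma).
have u0 : 0 < u by rewrite mulr_gt0// powR_gt0.
have a1 : 1 <= N%:R `^ gamma by rewrite -[leLHS](powRr0 N%:R) ler_powR// invr_ge0 ltW.
(* The growth condition with [a] = N^gamma gives K1 * N * Phi(u) <= Phi(h) = N. The maximum with 1
   meets the range in which both conditions on [Phi] apply. *)
have PuB : Phi (Num.max u 1) <= B.
  have [u1|/ltW u1] := leP u 1; first by case: orlPhi => _ _ _ _ ->.
  rewrite le_max; apply/orP; right.
  have := growPhi _ _ a1 u1; rewrite -powRrM mulVf ?gt_eqF// powRr1 ?(ltW NR0)//.
  rewrite [_ * u]mulrCA powRN divff ?gt_eqF ?powR_gt0// mulr1 Ph.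
  rewrite mulrAC -[leRHS]mul1r ler_pM2r// -[K1^-1]mul1r ler_pdivlMr//.
  by rewrite mulrC.
have max1 : 1 <= Num.max u 1 by rewrite le_max lexx orbT.
pose S (w : {ffun 'I_N -> A}) : nat := (\sum_j hit (w j))%N.
have coef : 7 / #|F|%:R <= 14 * (N%:R `^ (- delta) * N%:R `^ (- gamma)) :> R.
  rewrite -powRD; last by rewrite (gt_eqF NR0) implybT.
  rewrite -opprD -dg powRN ler_pdivrMr// mulrAC ler_pdivlMr ?powR_gt0//; lra.
have step w : Phi (`|f k w - \sum_(i < n) c k i * gen i w| / l)
    <= (expR D)^-1 * D ^+ S w.
  have max0 : 0 <= Num.max u 1 by exact: le_trans max1.
  (* The factor [expR D] in [l] appears inverted inside [Phi]; convexity moves it outside, where it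
     cancels the moment bound. *)
  apply: (@le_trans _ _ (Phi ((expR D)^-1 * ((S w)%:R * Num.max u 1)))).
    apply: orlicz_homo => //; first by rewrite divr_ge0// ltW.
    rewrite ler_pdivrMr//; apply: le_trans (approx k w) _.
    have -> : \sum_j `|f j w| = h * (S w)%:R.
      by rewrite natr_sum mulr_sumr; apply: eq_bigr => j _; rewrite normv.
    apply: (@le_trans _ _ ((expR D)^-1 * ((S w)%:R * u) * l)); last first.
      rewrite ler_wpM2r ?(ltW l0)// ler_wpM2l ?invr_ge0 ?expR_ge0//.
      by rewrite ler_wpM2l// le_max lexx.
    rewrite [leRHS](_ : _ =
        14 * (N%:R `^ (- delta) * N%:R `^ (- gamma)) * (h * (S w)%:R)).
      by rewrite ler_wpM2r// mulr_ge0// ltW.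
    by rewrite /l /u /C; field; rewrite gt_eqF ?expR_gt0.
  apply: le_trans (orlicz_scale orlPhi _ _) _.
  - by rewrite invr_ge0 expR_ge0 invf_le1 ?expR_gt0// -expR0 ler_expR (le_trans _ D1).
  - by rewrite mulr_ge0.
  by rewrite ler_wpM2l ?invr_ge0 ?expR_ge0// orlicz_multiple.
apply: le_trans (ler_sum _ (fun w _ => step w)) _.
rewrite -mulr_sumr ler_pdivrMl ?expR_gt0// mulrC.
by apply: sum_expr_count => //; rewrite sum_hit mulrC.
Qed.
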